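(* The odd writhe polynomial is a virtual knot invariant: if $D$ and $D'$ are two virtual knot diagrams representing the same virtual knot (i.e. related by a finite sequence of generalized Reidemeister moves), then $f_D(t)=f_{D'}(t)$ in $\mathbb{Z}[t,t^{-1}]$.
   Context: All virtual knot diagrams are oriented. A virtual knot diagram is a planar 4-valent graph (the image of one immersed oriented closed curve) in which each vertex is either a real crossing (with over/under information) or a virtual crossing. Two diagrams represent the same virtual knot if they are connected by a finite sequence of generalized Reidemeister moves: the classical moves $\Omega_1,\Omega_2,\Omega_3$ (on real crossings), their virtual versions $\Omega_1',\Omega_2',\Omega_3'$ (all crossings virtual), and the semivirtual third move $\Omega_3^s$ (a strand with two consecutive virtual crossings passes across a real crossing). The Gauss diagram of $D$ is an anticlockwise oriented circle with one chord for each real crossing, joining the two preimages of the crossing. Each chord is oriented from the preimage of the overcrossing to the preimage of the undercrossing and carries the sign $w(c)\in\{+1,-1\}$ equal to the writhe of the crossing. Crossings and chords are denoted by the same letter $c$. The over-endpoint of $c$ is $c^+$ and the under-endpoint is $c^-$. The moves $\Omega_1',\Omega_2',\Omega_3',\Omega_3^s$ do not change the Gauss diagram, and a Gauss diagram determines its virtual knot uniquely. A chord $c$ (and the real crossing $c$) is odd if the number of endpoints of other chords lying on one (equivalently, on each) of the two open arcs of the circle bounded by $c^+$ and $c^-$ is odd; otherwise it is even. $Odd(D)$ is the set of odd crossings. If $D$ has $n$ real crossings, the $2n$ chord endpoints divide the circle into $2n$ arcs. For an arc $a$, choose a point in $a$ and travel once along the circle in its orientation; $N(a)$ is the sum of $w(c)$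 over all chords $c$ for which $c^+$ is met before $c^-$. For a chord $c$ define $N(c)\in\mathbb{Z}$ as follows: if $w(c)=+1$, $N(c)=N(\text{arc immediately after }c^-)-N(\text{arc immediately after }c^+)$; if $w(c)=-1$, $N(c)=N(\text{arc immediately before }c^-)-N(\text{arc immediately before }c^+)$, where before/after refer to the orientation of the circle. The odd writhe polynomial of the diagram $D$ is $f_D(t)=\sum_{c\in Odd(D)}w(c)\,t^{N(c)}\in\mathbb{Z}[t,t^{-1}]$ (equal to $0$ if there are no odd crossings). *)

(* Defs.v *)
From HB Require Import structures.
From mathcomp Require Import all_boot all_order all_algebra.
From Stdlib Require Export Relation_Operators.

Set Implicit Arguments.
Unset Strict Implicit.
Unset Printing Implicit Defensive.

Import GRing.Theory.

(* An oriented virtual knot diagram is encoded by the cyclic word of crossings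
   met along the curve, all crossings included, together with the local
   geometry at each crossing. This determines the immersed curve, with its
   over/under/virtual information, up to orientation-preserving homeomorphism
   of the sphere. The word is realizable by a planar curve exactly when the
   cellular surface it describes has genus 0 (see [planar]). *)

(* [Real true] is a positive crossing, [Real false] a negative one. *)
Inductive kind := Virtual | Real of bool.

Definition option_of_kind k := if k is Real s then Some s else None.
Definition kind_of_option o := if o is Some s then Real s else Virtual.
Lemma option_of_kindK : cancel option_of_kind kind_of_option.
Proof. by case. Qed.
HB.instance Definition _ := Countable.copy kind (can_type option_of_kindK).

(* A label together with the kind: crossings with the same label and different
   kinds are different crossings. *)
Notation crossing := (nat * kind)%type.

(* A passage of the curve through a crossing, on one of its two strands. At a
   real crossing the strand [true] is the over strand. At a virtual crossing
   the strand [true] is the one crossed from right to left by the other. *)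
Notation passage := (crossing * bool)%type.

Definition opp (p : passage) : passage := (p.1, ~~ p.2).

Definition virtual (p : passage) := p.1.2 == Virtual.
Definition real (p : passage) := ~~ virtual p.

(* Whether the direction of the strand [true] followed by the direction of the
   strand [false] is a positively oriented frame of the plane; for a real
   crossing this is the usual definition of a positive writhe. *)
Definition positive_frame (c : crossing) := if c.2 is Real s then s else true.

(* Whether the strand of [p] is crossed from right to left by the other one. *)
Definition crossed_leftwards (p : passage) := p.2 == positive_frame p.1.

(* A dart [(p, d)] is the edge leaving the passage [p], forwards along the
   curve if [d] and backwards otherwise. Someone arriving at the passage [q]
   (forwards if [d]) and turning left leaves along the dart [turn d q]. *)
Notation dart := (passage * bool)%type.

Definition turn (d : bool) (q : passage) : dart :=
  (opp q, d == crossed_leftwards q).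

Definition darts (w : seq passage) : seq dart :=
  [seq (p, d) | p <- w, d <- [:: true; false]].

Definition turn_left (w : seq passage) (x : dart) : dart :=
  turn x.2 (if x.2 then next w x.1 else prev w x.1).

(* For a [closed_curve] the default value of [insubd] is never used. *)
Definition face_step (w : seq passage) (x : seq_sub (darts w)) :
  seq_sub (darts w) := insubd x (turn_left w (val x)).

Definition faces (w : seq passage) : nat := fcard (@face_step w) predT.

(* Each crossing is passed exactly once on each strand. *)
Definition closed_curve (w : seq passage) : bool :=
  uniq w && all (fun p => opp p \in w) w.

(* Euler's formula V + F = E + 2, with 4-valent vertices; the empty word is the
   circle without crossings. *)
Definition planar (w : seq passage) : bool :=
  (w == [::]) || ((size w)./2 + faces w == size w + 2).

Record vdiagram := VDiagram {
  word :> seq passage;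
  word_closed : closed_curve word;
  word_planar : planar word
}.

(* A short strand, i.e. an edge joining two consecutive passages [e.1], [e.2],
   traversed forwards or backwards. *)
Definition source (e : passage * passage) (d : bool) := if d then e.1 else e.2.
Definition target (e : passage * passage) (d : bool) := if d then e.2 else e.1.

Definition corner e (d : bool) e' (d' : bool) : bool :=
  turn d (target e d) == (source e' d', d').

(* The three strands bound a triangular face, on the left when they are
   traversed in this order (and in suitable directions). *)
Definition triangle e1 e2 e3 : Prop := exists d1 d2 d3 : bool,
  [/\ corner e1 d1 e2 d2, corner e2 d2 e3 d3 & corner e3 d3 e1 d1].

Definition strand (e : passage * passage) : seq passage := [:: e.1; e.2].
Definition swap (e : passage * passage) := (e.2, e.1).

Definition word3 e1 s1 e2 s2 e3 s3 : seq passage :=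
  strand e1 ++ s1 ++ strand e2 ++ s2 ++ strand e3 ++ s3.

(* [x] and [y] are consecutive on one strand, [z] is the other strand, in
   either direction, which crosses the first one at [x] and crosses back at
   [y]; hence the two strands bound a bigonal face. *)
Definition bigon (x y : passage) (z : seq passage) : Prop :=
  crossed_leftwards x != crossed_leftwards y /\
  (z = [:: opp x; opp y] \/ z = [:: opp y; opp x]).

Inductive move : seq passage -> seq passage -> Prop :=
(* the same diagram, with another base point or other labels *)
| Rotate n w : move w (rot n w)
| Relabel (f : crossing -> crossing) w :
    (forall c, (f c).2 = c.2) -> move w [seq (f p.1, p.2) | p <- w]
| Omega1 x s : real x -> move [:: x, opp x & s] s
| Omega1_virtual x s : virtual x -> move [:: x, opp x & s] s
(* one strand is over the other one at both crossings *)
| Omega2 x y z s t :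
    real x -> real y -> x.2 = y.2 -> bigon x y z ->
    move ([:: x; y] ++ s ++ z ++ t) (s ++ t)
| Omega2_virtual x y z s t :
    virtual x -> virtual y -> bigon x y z ->
    move ([:: x; y] ++ s ++ z ++ t) (s ++ t)
(* the strands are at three different heights: one is over the two others *)
| Omega3 e1 e2 e3 s1 s2 s3 :
    triangle e1 e2 e3 \/ triangle e1 e3 e2 ->
    all real (strand e1 ++ strand e2 ++ strand e3) ->
    has (fun e => e.1.2 && e.2.2) [:: e1; e2; e3] ->
    move (word3 e1 s1 e2 s2 e3 s3)
         (word3 (swap e1) s1 (swap e2) s2 (swap e3) s3)
| Omega3_virtual e1 e2 e3 s1 s2 s3 :
    triangle e1 e2 e3 \/ triangle e1 e3 e2 ->
    all virtual (strand e1 ++ strand e2 ++ strand e3) ->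
    move (word3 e1 s1 e2 s2 e3 s3)
         (word3 (swap e1) s1 (swap e2) s2 (swap e3) s3)
(* one real crossing (counted on both strands) and two virtual ones *)
| Omega3_semivirtual e1 e2 e3 s1 s2 s3 :
    triangle e1 e2 e3 \/ triangle e1 e3 e2 ->
    count real (strand e1 ++ strand e2 ++ strand e3) = 2 ->
    move (word3 e1 s1 e2 s2 e3 s3)
         (word3 (swap e1) s1 (swap e2) s2 (swap e3) s3).

Definition same_virtual_knot : vdiagram -> vdiagram -> Prop :=
  clos_refl_sym_trans vdiagram (fun D D' => move D D').

(* The Gauss diagram, as the cyclic word of chord endpoints read along the
   circle; [(c, true)] is c^+ and [(c, false)] is c^-. *)
Definition gauss_diagram (D : vdiagram) : seq passage :=
  [seq p <- word D | real p].

Definition chords (g : seq passage) : seq crossing :=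
  [seq p.1 | p <- g & p.2].

Local Open Scope ring_scope.

Definition writhe (c : crossing) : int := if positive_frame c then 1 else -1.

(* [u] is the circle cut open at a point of the arc. *)
Definition N_arc (u : seq passage) : int :=
  \sum_(c <- chords u | (index (c, true) u < index (c, false) u)%N) writhe c.

Definition N_after (g : seq passage) (p : passage) : int :=
  N_arc (rot (index p g).+1 g).
Definition N_before (g : seq passage) (p : passage) : int :=
  N_arc (rot (index p g) g).

Definition N_chord (g : seq passage) (c : crossing) : int :=
  if writhe c == 1 then N_after g (c, false) - N_after g (c, true)
  else N_before g (c, false) - N_before g (c, true).

(* [arc g x y] contains its first endpoint [x] but not [y]. *)
Definition odd_chord (g : seq passage) (c : crossing) : bool :=
  odd (size (behead (arc g (c, true) (c, false)))).

(* Z[t, t^-1] is regarded as a subring of the fraction field of Z[t]. *)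
Definition odd_writhe_polynomial (D : vdiagram) : {fraction {poly int}} :=
  let g := gauss_diagram D in
  \sum_(c <- chords g | odd_chord g c)
    (writhe c)%:~R * (tofrac 'X) ^ (N_chord g c).

(* Main.v *)
From mathcomp Require Import all_boot all_order all_algebra.
From mathcomp Require Import zify ring.
Require Import Defs.

(** When the base point of the circle moves past a chord endpoint [p], the sum
    N(a) changes by an amount depending only on [p]: the chord starts to count
    or ceases to count. The change is -1 if the strand of [p] is crossed
    leftwards and +1 otherwise. Adding these changes up along the circle gives
    a height function on the endpoints, single-valued because the two ends of a
    chord contribute opposite amounts. In terms of the rise of this height from
    c^+ to c^-, the number N(c) is the rise plus w(c) + 1, uniformly in the sign
    of c ([N_chord_rise]). Counting the endpoints modulo 2 along with the height
    gives a second component of the rise that decides whether c is odd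
    ([odd_chord_rise]). Both components obey the same rules: the step at an
    endpoint is a fixed element of an abelian group, here Z x Z/2, or its
    opposite, according to the direction of the crossing strand. The polynomial
    thus depends only on the rises and signs of the chords, and what remains is
    to follow the rises through the moves of the real crossings.

    - First move: the new chord has adjacent ends, so it is even, and its two
      steps cancel for all other chords.
    - Second move: the steps along each of the two strands cancel, so no other
      chord is affected; the rises of the two opposite crossings differ by
      exactly what makes N equal, so that their terms cancel
      ([contribution_cancel]).
    - Third move: exchanging two adjacent endpoints raises each of them, up to
      sign, by the step of the other. Turning left at each corner of the
      triangle ties the directions of its sides to the three crossing signs in
      such a way that both ends of each crossing are raised by the same amount
      ([shift_triangle]); hence all rises are preserved.

    The moves with virtual crossings do not change the Gauss diagram; for the
    mixed third move this is because at most one endpoint of each side of the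
    triangle is real ([gauss_Omega3_single_real]). *)

Set Implicit Arguments.
Unset Strict Implicit.
Unset Printing Implicit Defensive.

Import GRing.Theory.
Local Open Scope ring_scope.

Implicit Types (p q x y : passage) (s t u g : seq passage).

(** * Passages and closed curves *)

Lemma oppK : involutive opp.
Proof. by case=> c b; rewrite /opp negbK. Qed.

Lemma opp_eq p q : (opp p == q) = (p == opp q).
Proof. by apply/eqP/eqP => [<-|->]; rewrite oppK. Qed.

Lemma opp_neq p : opp p == p = false.
Proof. by case: p => c [] /=; rewrite /opp xpair_eqE andbF. Qed.

Lemma closed_uniq g : closed_curve g -> uniq g.
Proof. by case/andP. Qed.

Lemma mem_opp g q : closed_curve g -> (opp q \in g) = (q \in g).
Proof.
case/andP=> _ /allP gopp; apply/idP/idP; last exact: gopp.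
by move/gopp; rewrite oppK.
Qed.

Lemma closed_perm g g' : perm_eq g g' -> closed_curve g -> closed_curve g'.
Proof.
move=> gg'; rewrite /closed_curve (perm_uniq gg') (perm_all _ gg').
by congr (_ && _); apply: eq_all => p; rewrite (perm_mem gg').
Qed.

Lemma closed_gauss w : closed_curve w -> closed_curve [seq p <- w | real p].
Proof.
move=> wcl; apply/andP; split; first exact/filter_uniq/closed_uniq.
by apply/allP => p; rewrite !mem_filter mem_opp // /real /virtual.
Qed.

(** * Altitude along the circle *)

(** The first component is the change of N(a) when the arc [a] moves forward
    past [p]; the second one is 1 modulo 2, so that sums of steps also count
    endpoints modulo 2. *)
Definition step p : int * bool :=
  if crossed_leftwards p then (-1, true) else (1, true).

Lemma step_opp p : step (opp p) = - step p.
Proof. by case: p => [[n [|[]]] []]. Qed.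

Definition altitude g p : int * bool := \sum_(q <- take (index p g) g) step q.

(** Meant for an over-endpoint [q], so that it goes from c^+ to c^-; the
    definition makes sense at both ends of a chord, with opposite values. *)
Definition rise g q := altitude g (opp q) - altitude g q.

Lemma altitude_cons p g q :
  altitude (p :: g) q = if p == q then 0 else step p + altitude g q.
Proof.
rewrite /altitude /=; case: eqP => _ /=; first by rewrite big_nil.
by rewrite big_cons.
Qed.

(** A passage absent from both words gets the total sum, since [index] is then
    the length. *)
Lemma altitude_cat s t q :
  altitude (s ++ t) q =
  if q \in s then altitude s q else \sum_(p <- s) step p + altitude t q.
Proof.
elim: s => [|p s IHs] /=; first by rewrite big_nil add0r.
rewrite !altitude_cons IHs inE (eq_sym q) big_cons.
by case: eqP => //= _; case: ifP => // _; rewrite addrA.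
Qed.

(** The two endpoints of each chord cancel, hence the altitude is well defined
    around the circle: closing up the word costs nothing. *)
Lemma sum_step g : closed_curve g -> \sum_(p <- g) step p = 0.
Proof.
move=> gcl; rewrite (bigID (fun p => p.2)) /=.
have gopp : perm_eq g (map opp g).
  apply: uniq_perm; rewrite ?(map_inj_uniq (inv_inj oppK)) ?closed_uniq //.
  by move=> p; rewrite -{2}[p]oppK (mem_map (inv_inj oppK)) mem_opp.
rewrite [X in _ + X](perm_big _ gopp) big_map /=.
have -> : \sum_(p <- g | ~~ ~~ p.2) step (opp p) = \sum_(p <- g | p.2) - step p.
  by apply: eq_big => [p|p _]; rewrite ?negbK ?step_opp.
by rewrite sumrN subrr.
Qed.

(** * The polynomial in terms of rises *)

Lemma N_arcE u : N_arc u =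
  \sum_(q <- u | q.2 && (index q u < index (opp q) u)%N) writhe q.1.
Proof.
rewrite /N_arc /chords big_map big_filter_cond.
by apply: eq_bigl => -[c []].
Qed.

(** Only the chord of [p] is affected: from the arc before [p], its end [p] is
    met first, and from the arc after [p] it is met last. *)
Lemma N_arc_rot1 p s : closed_curve (p :: s) ->
  N_arc (rcons s p) = N_arc (p :: s) + (step p).1.
Proof.
move=> gcl; have /= /andP[pNs suniq] := closed_uniq gcl.
have op_s : opp p \in s.
  by have := mem_opp p gcl; rewrite !inE eqxx opp_neq.
rewrite !N_arcE big_rcons big_cons /=.
rewrite !(big_rem _ op_s) /= oppK.
rewrite -cats1 !index_cat /= !eqxx (negPf pNs) op_s addn0 ltn0 andbF.
rewrite [p == opp p]eq_sym opp_neq index_mem op_s ltn0Sn.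
rewrite [(size s < _)%N]ltnNge index_size andbF !andbT.
set S := \sum_(i <- rem _ s | _) _; set S' := \sum_(i <- rem _ s | _) _.
have -> : S = S'.
  rewrite /S /S' big_seq_cond [RHS]big_seq_cond; apply: eq_bigl => q.
  rewrite mem_rem_uniq // !inE.
  have [/andP[qNop qs]|//] := boolP ((q != opp p) && (q \in s)).
  rewrite /= !index_cat qs /=.
  have -> : p == q = false by apply: contraNF pNs => /eqP ->.
  have oqs : opp q \in s.
    by have := mem_opp q gcl; rewrite !inE opp_eq (negPf qNop) qs orbT.
  have -> : p == opp q = false by rewrite eq_sym opp_eq (negPf qNop).
  by rewrite oqs ltnS.
move: (S') => S1; case: p {gcl pNs op_s S S'} => [[n [|[]]] []];
  rewrite /step /writhe /=; lia.
Qed.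

Lemma N_arc_rot k g : closed_curve g -> (k <= size g)%N ->
  N_arc (rot k g) = N_arc g + (\sum_(q <- take k g) step q).1.
Proof.
move=> gcl; elim: k => [|k IHk] klt; first by rewrite rot0 take0 big_nil addr0.
pose x0 : passage := ((0%N, Virtual), true).
rewrite rotS // (take_nth x0 klt) big_rcons /=.
have {IHk} := IHk (ltnW klt); set p := nth _ _ _.
have -> : rot k g = p :: drop k.+1 g ++ take k g.
  by rewrite /rot (drop_nth x0 klt).
move=> /= E; rewrite rot1_cons N_arc_rot1 ?E.
  by rewrite -addrA; congr (_ + _); rewrite addrC.
apply: closed_perm gcl.
by rewrite -{1}(cat_take_drop k g) (drop_nth x0 klt) perm_catC.
Qed.

Lemma N_before_altitude g p : closed_curve g ->
  N_before g p = N_arc g + (altitude g p).1.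
Proof. by move=> gcl; rewrite /N_before N_arc_rot ?index_size. Qed.

Lemma N_after_altitude g p : closed_curve g -> p \in g ->
  N_after g p = N_arc g + (altitude g p).1 + (step p).1.
Proof.
move=> gcl pg; rewrite /N_after N_arc_rot ?index_mem //.
rewrite (take_nth p) ?index_mem // nth_index // big_rcons /= -addrA.
by congr (_ + _); rewrite addrC.
Qed.

(** For a positive chord, N is compared after the two endpoints, which adds the
    steps +1 at c^- and -1 at c^+ and makes 2; for a negative one N is compared
    before them, which adds 0. *)
Lemma N_chord_rise g c : closed_curve g -> (c, true) \in g ->
  N_chord g c = (rise g (c, true)).1 + writhe c + 1.
Proof.
move=> gcl cg.
have ocg : (c, false) \in g by have := mem_opp (c, true) gcl; rewrite cg.
rewrite /N_chord !N_before_altitude // !N_after_altitude // /rise /opp /=.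
by case: c cg ocg => [n [|[]]] _ _; rewrite /step /writhe /=; lia.
Qed.

Lemma sum_step_parity s : (\sum_(q <- s) step q).2 = odd (size s).
Proof.
elim: s => [|q s IHs]; first by rewrite big_nil.
rewrite big_cons /= -IHs /step.
by case: crossed_leftwards; case: (\sum_(j <- s) _).2.
Qed.

Lemma altitude_parity g p : (altitude g p).2 = odd (index p g).
Proof. by rewrite /altitude sum_step_parity size_takel ?index_size. Qed.

(** The rotated word starts from altitude 0 again, which subtracts the altitude of
    the new base point everywhere, also across the old base point because the
    total is 0. *)
Lemma altitude_rot g k q : closed_curve g ->
  q \in g -> altitude (rot k g) q = altitude g q - \sum_(p <- take k g) step p.
Proof.
rewrite /rot -{1 2 5}(cat_take_drop k g); move: (take k g) (drop k g) => s t stcl.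
have st0 := sum_step stcl; have := closed_uniq stcl.
rewrite big_cat /= in st0; rewrite cat_uniq => /and3P[_ /hasPn tNs _].
rewrite mem_cat !altitude_cat => /orP[qs|qt].
  have /negPf -> : q \notin t by apply: contraL qs => /tNs.
  by rewrite qs (addr0_eq st0) addrC.
by rewrite qt (negPf (tNs q qt)) addrC addKr.
Qed.

(** The difference of positions counts the endpoints strictly inside the arc and
    one more, whence the negation. *)
Lemma odd_chord_rise g c : closed_curve g -> (c, true) \in g ->
  odd_chord g c = ~~ (rise g (c, true)).2.
Proof.
move=> gcl cg.
have ocg : (c, false) \in g by have := mem_opp (c, true) gcl; rewrite cg.
have cNoc : (c, true) != (c, false) by rewrite xpair_eqE andbF.
rewrite /odd_chord /arc size_behead size_takel ?index_size //.
rewrite /rise /opp [altitude g (c, true)]/altitude -altitude_rot //=.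
by rewrite altitude_parity rot_index //= (negPf cNoc) /= negbK.
Qed.

(** The rise [r] vanishes in its second component exactly for odd chords. *)
Definition contribution c (r : int * bool) : {fraction {poly int}} :=
  if r.2 then 0 else (writhe c)%:~R * tofrac 'X ^ (r.1 + writhe c + 1).

Definition chord_sum g : {fraction {poly int}} :=
  \sum_(q <- g | q.2) contribution q.1 (rise g q).

Lemma odd_writhe_polynomial_chord_sum D :
  odd_writhe_polynomial D = chord_sum (gauss_diagram D).
Proof.
have gcl : closed_curve (gauss_diagram D) by exact/closed_gauss/word_closed.
rewrite /odd_writhe_polynomial /chord_sum /chords.
move: (gauss_diagram D) gcl => g gcl.
rewrite big_map big_filter_cond big_mkcond [RHS]big_mkcond.
apply: eq_big_seq => -[c []] //= cg; rewrite /contribution odd_chord_rise //.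
by rewrite N_chord_rise //; case: (rise _ _).2.
Qed.

Lemma eq_chord_sum g g' : perm_eq g g' -> {in g, rise g =1 rise g'} ->
  chord_sum g = chord_sum g'.
Proof.
move=> gg' rr'; rewrite /chord_sum -(perm_big _ gg') /=.
rewrite big_seq_cond [RHS]big_seq_cond.
by apply: eq_bigr => q /andP[qg _]; rewrite rr'.
Qed.

(** * Change of base point and of labels *)

Lemma chord_sum_rot g k : closed_curve g -> chord_sum (rot k g) = chord_sum g.
Proof.
move=> gcl; apply/esym/eq_chord_sum; first by rewrite perm_sym perm_rot.
move=> q qg; rewrite /rise !altitude_rot ?mem_opp //.
by rewrite opprB addrA addrNK.
Qed.

(** A relabelling may identify labels in general; that the image is a diagram
    prevents this on the crossings that occur. *)
Lemma altitude_map (f : crossing -> crossing) g p :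
    (forall c, (f c).2 = c.2) -> uniq [seq (f q.1, q.2) | q <- g] -> p \in g ->
  altitude [seq (f q.1, q.2) | q <- g] (f p.1, p.2) = altitude g p.
Proof.
move=> fk; elim: g => //= q g IHg /andP[qNg guniq].
have sf : step (f q.1, q.2) = step q.
  by rewrite /step /crossed_leftwards /positive_frame /= fk.
rewrite !altitude_cons sf inE; have [->|pNq] /= := eqVneq p q; first by rewrite !eqxx.
move=> pg; rewrite IHg //; case: eqP => // E.
by case/mapP: qNg; exists p.
Qed.

Lemma chord_sum_map (f : crossing -> crossing) g :
    (forall c, (f c).2 = c.2) -> closed_curve g ->
    uniq [seq (f q.1, q.2) | q <- g] ->
  chord_sum [seq (f q.1, q.2) | q <- g] = chord_sum g.
Proof.
move=> fk gcl funiq; rewrite /chord_sum big_map /= big_seq_cond [RHS]big_seq_cond.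
apply: eq_bigr => q /andP[qg _].
rewrite /rise -[opp (_, _)]/(f (opp q).1, (opp q).2) !altitude_map ?mem_opp //.
by rewrite /contribution /writhe /positive_frame fk.
Qed.

(** * The first move *)

Lemma chord_sum_Omega1 x s : closed_curve (x :: opp x :: s) ->
  chord_sum (x :: opp x :: s) = chord_sum s.
Proof.
move=> gcl; have /= := closed_uniq gcl; rewrite inE !negb_or.
case/and3P=> /andP[_ xNs] oxNs _.
have outer q : q \in s -> rise (x :: opp x :: s) q = rise s q.
  move=> qs; have qNx : x == q = false by apply: contraNF xNs => /eqP->.
  have qNox : opp x == q = false by apply: contraNF oxNs => /eqP->.
  have oqNox : opp x == opp q = false by rewrite (inj_eq (inv_inj oppK)).
  have oqNx : x == opp q = false by rewrite -opp_eq.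
  by rewrite /rise !altitude_cons qNx qNox oqNx oqNox step_opp !addNKr.
(* The ends of the new chord are one step apart, hence it is even. *)
have inner q : (q == x) || (q == opp x) ->
    contribution q.1 (rise (x :: opp x :: s) q) = 0.
  rewrite /contribution /rise => /orP[]/eqP->; rewrite ?oppK !altitude_cons !eqxx /=;
    by rewrite eq_sym opp_neq /step; case: crossed_leftwards.
rewrite /chord_sum !big_cons !inner ?eqxx ?orbT // !add0r.
rewrite !if_same big_seq_cond [RHS]big_seq_cond.
by apply: eq_bigr => q /andP[qs _]; rewrite outer.
Qed.

(** * The second move *)

Lemma rise_opp g q : rise g (opp q) = - rise g q.
Proof. by rewrite /rise oppK opprB. Qed.

(** The writhe of a chord is minus the step at its over-endpoint, so passing from
    [q] to [q'] the term w + 1 of N increases by twice the step of [q], which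
    makes up for the difference of the rises; the signs are opposite. *)
Lemma contribution_cancel q q' r r' :
    q.2 -> q'.2 -> step q' = - step q -> r' = r - step q *+ 2 ->
  contribution q.1 r + contribution q'.1 r' = 0.
Proof.
move=> q2 q2' sqq' ->; rewrite /contribution.
have -> : (r - step q *+ 2).2 = r.2.
  by case: r => r [] /=; rewrite /step; case: crossed_leftwards.
case: ifP => _; first by rewrite addr0.
have wE p : p.2 -> writhe p.1 = - (step p).1.
  by case: p => [[n [|[]]] []].
rewrite !wE // sqq' /=.
have -> : r.1 - ((step q).1 + (step q).1) - - (step q).1 + 1 =
    r.1 - (step q).1 + 1 by ring.
by rewrite -mulrDl -intrD opprK addNr mul0r.
Qed.

Lemma chord_sum_Omega2 x y z s t :
    closed_curve ([:: x; y] ++ s ++ z ++ t) -> x.2 = y.2 -> bigon x y z ->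
  chord_sum ([:: x; y] ++ s ++ z ++ t) = chord_sum (s ++ t).
Proof.
move=> gcl xy2 [cxy zE].
have sy : step y = - step x.
  by move: cxy; rewrite /step; do 2!case: crossed_leftwards.
have zP : z =i [:: opp x; opp y].
  by case: zE => -> // q; rewrite !inE orbC.
have z0 : \sum_(q <- z) step q = 0.
  by case: zE => ->; rewrite !big_cons big_nil !step_opp sy !opprK addr0
    ?addNr ?subrr.
have xy0 : \sum_(q <- [:: x; y]) step q = 0.
  by rewrite !big_cons big_nil sy addr0 subrr.
have zp : perm_eq z [:: opp x; opp y].
  by case: zE => -> //; rewrite (perm_catC [:: _] [:: _]).
set g := _ ++ _; have gp : perm_eq g ([:: x; y] ++ z ++ s ++ t).
  by rewrite perm_cat2l perm_catCA.
have := closed_uniq gcl; rewrite -/g (perm_uniq gp) !cat_uniq.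
case/and5P=> xyuniq /hasPn xyN zuniq /hasPn zN _.
have outer q : q \in s ++ t -> altitude g q = altitude (s ++ t) q.
  move=> qst.
  have /negPf qNxy : q \notin [:: x; y] by rewrite xyN // mem_cat qst orbT.
  by rewrite /g !altitude_cat qNxy (negPf (zN q qst)) xy0 z0 !add0r.
have onz q : q \in z -> altitude g q = \sum_(p <- s) step p + altitude z q.
  move=> qz; have /negPf qNxy : q \notin [:: x; y] by rewrite xyN // mem_cat qz.
  have /negPf qNs : q \notin s.
    by apply: contraL qz => qs; rewrite zN // mem_cat qs.
  by rewrite /g !altitude_cat qNxy qNs qz xy0 add0r.
have xNy : (x == y) = false by move: xyuniq; rewrite /= inE andbT => /negPf.
have oxNoy : (opp x == opp y) = false by rewrite (inj_eq (inv_inj oppK)).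
(* For parallel strands [y] and [opp y] come one step after [x] and [opp x];
   for antiparallel ones [opp x] comes one step after [opp y] instead. *)
have inner : rise g y = rise g x - step x *+ 2.
  rewrite /rise (onz (opp x)) ?(onz (opp y)) ?zP ?inE ?eqxx ?orbT // /g.
  rewrite !altitude_cons !eqxx xNy.
  case: zE => ->; rewrite !altitude_cons !eqxx ?[opp y == _]eq_sym ?oxNoy.
    by rewrite step_opp !addr0 mulr2n opprD addrA.
  by rewrite step_opp sy opprK !addr0 mulr2n opprD addrA addrK.
rewrite /chord_sum (perm_big _ gp) big_cat /= big_cat /= (perm_big _ zp) /=.
(* The chord of [x] starts at [x] or at [opp x], and that of [y] likewise. *)
rewrite addrA [X in X + _](_ : _ = 0) ?add0r; last first.
  rewrite !big_cons !big_nil /= -xy2 !rise_opp.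
  case x2: x.2; rewrite /= ?add0r ?addr0.
    by apply: (@contribution_cancel x y); rewrite // -xy2.
  apply: (@contribution_cancel (opp x) (opp y)); rewrite /= -?xy2 ?x2 //.
    by rewrite !step_opp sy.
  by rewrite step_opp inner opprB mulNrn opprK addrC.
rewrite big_seq_cond [RHS]big_seq_cond; apply: eq_bigr => q /andP[qst _].
suff oqst : opp q \in s ++ t by rewrite /rise !outer.
have qNxy : q \notin [:: x; y] by rewrite xyN // mem_cat qst orbT.
have qNz := zN q qst.
have : opp q \in [:: x; y] ++ z ++ s ++ t.
  by rewrite -(perm_mem gp) mem_opp // (perm_mem gp) !mem_cat -mem_cat qst !orbT.
rewrite catA mem_cat => /orP[|//]; rewrite mem_cat => /orP[|].
  by move=> oq; case/negP: qNz; rewrite zP !inE -!opp_eq; move: oq; rewrite !inE.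
by rewrite zP !inE !(inj_eq (inv_inj oppK)) => oq; case/negP: qNxy; rewrite !inE.
Qed.

(** * The third move *)

(** The change of the altitude of [p] when the ends of [e] are exchanged. *)
Definition shift e p : int * bool :=
  (if p == e.1 then step e.2 else 0) - (if p == e.2 then step e.1 else 0).

Lemma altitude_swap s e t p : uniq (s ++ strand e ++ t) ->
  altitude (s ++ strand (swap e) ++ t) p =
  altitude (s ++ strand e ++ t) p + shift e p.
Proof.
case: e => a b; rewrite cat_uniq /= => /and3P[_ /norP[aNs /norP[bNs _]]].
rewrite inE negb_or => /andP[/andP[aNb _] _].
rewrite !altitude_cat /shift /=; case: ifP => [ps|_].
  rewrite !ifN ?subr0 ?addr0 //; apply: contraTneq ps => -> //.
rewrite !altitude_cons -addrA; congr (_ + _).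
rewrite ![p == _]eq_sym; case: (eqVneq a p) => [<-|_].
  by rewrite [b == a]eq_sym (negPf aNb) add0r !addr0.
case: eqP => _; first by rewrite add0r addr0 subrr.
by rewrite !addr0 addrCA.
Qed.

Lemma altitude_word3_swap e1 s1 e2 s2 e3 s3 p :
    uniq (word3 e1 s1 e2 s2 e3 s3) ->
  altitude (word3 (swap e1) s1 (swap e2) s2 (swap e3) s3) p =
  altitude (word3 e1 s1 e2 s2 e3 s3) p + (shift e1 p + shift e2 p + shift e3 p).
Proof.
move=> guniq.
have uniq_swap s e t :
    uniq (s ++ strand (swap e) ++ t) = uniq (s ++ strand e ++ t).
  by apply: perm_uniq; rewrite perm_cat2l perm_cat2r (perm_catC [:: _] [:: _]).
rewrite /word3 in guniq *.
have u3 : uniq (strand e1 ++ s1 ++ strand e2 ++ s2 ++ strand (swap e3) ++ s3).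
  have := uniq_swap (strand e1 ++ s1 ++ strand e2 ++ s2) e3 s3.
  by rewrite -!catA => ->.
have u2 : uniq (strand e1 ++ s1 ++ strand (swap e2) ++ s2 ++
                strand (swap e3) ++ s3).
  have := uniq_swap (strand e1 ++ s1) e2 (s2 ++ strand (swap e3) ++ s3).
  by rewrite -!catA => ->.
have E1 := @altitude_swap [::] e1 _ p u2.
have E2 := @altitude_swap (strand e1 ++ s1) e2 (s2 ++ strand (swap e3) ++ s3) p.
have E3 := @altitude_swap (strand e1 ++ s1 ++ strand e2 ++ s2) e3 s3 p.
rewrite -!catA in E2 E3; rewrite [LHS]E1 E2 // E3 //.
move: (shift e1 p) (shift e2 p) (shift e3 p) => v1 v2 v3.
by rewrite -!addrA [v3 + _]addrC -addrA [v2 + _]addrCA.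
Qed.

(** The sign for a side travelled forwards or backwards around the triangle. *)
Definition along (d : bool) (v : int * bool) := if d then v else - v.

Lemma shift_oriented e d p :
  shift e p = (if p == source e d then along d (step (target e d)) else 0)
    - (if p == target e d then along d (step (source e d)) else 0).
Proof.
rewrite /shift /along; case: d => //=; rewrite addrC.
by congr (_ + _); case: ifP; rewrite ?opprK ?oppr0.
Qed.

(** Let [ai] be the endpoint where the boundary walk leaves the side [ei], so that
    the next side starts at [opp ai]. The rule for turning left says that the
    step at [ai] is minus the product of the direction signs of its two sides.
    So at the crossing of the sides i and j, the raise due to either of them is,
    up to the same sign, the direction sign of the third side. *)
Lemma shift_triangle e1 e2 e3 p : triangle e1 e2 e3 ->
  shift e1 (opp p) + shift e2 (opp p) + shift e3 (opp p) =
  shift e1 p + shift e2 p + shift e3 p.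
Proof.
have stepE q : step q = along (~~ crossed_leftwards q) (1, true).
  by rewrite /step /along; case: crossed_leftwards.
case=> d1 [d2 [d3 [/eqP[c12 t12] /eqP[c23 t23] /eqP[c31 t31]]]].
rewrite !(shift_oriented e1 d1) !(shift_oriented e2 d2) !(shift_oriented e3 d3).
rewrite -c12 -c23 -c31 !step_opp.
move: (target e1 d1) (target e2 d2) (target e3 d3) t12 t23 t31 {c12 c23 c31}.
move=> a1 a2 a3 t12 t23 t31.
rewrite !opp_eq !oppK.
(* Each strand shifts the two crossings at its ends; these equations say that
   the two strands through a crossing shift both of its endpoints equally. *)
have [k1 k2 k3] : [/\ along d2 (step a2) = along d1 (step a3),
    along d2 (step a1) = along d3 (step a3) &
    along d3 (step a2) = along d1 (step a1)].
  rewrite !stepE; move: t12 t23 t31; do 3!case: crossed_leftwards;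
    by case: d1; case: d2; case: d3.
have alongN d v : along d (- v) = - along d v by case: d.
rewrite !alongN k1 k2 k3 -!mulrb !mulNrn !opprK.
by ring.
Qed.

Lemma chord_sum_Omega3 e1 s1 e2 s2 e3 s3 :
    triangle e1 e2 e3 \/ triangle e1 e3 e2 ->
    closed_curve (word3 e1 s1 e2 s2 e3 s3) ->
  chord_sum (word3 (swap e1) s1 (swap e2) s2 (swap e3) s3) =
  chord_sum (word3 e1 s1 e2 s2 e3 s3).
Proof.
move=> tri gcl; have altE p := altitude_word3_swap p (closed_uniq gcl).
apply/esym/eq_chord_sum => [|q _].
  have pswap e : perm_eq (strand e) (strand (swap e)).
    by rewrite (perm_catC [:: _] [:: _]).
  by rewrite /word3 !(perm_cat (pswap _), perm_cat2l, perm_cat).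
have -> : rise (word3 (swap e1) s1 (swap e2) s2 (swap e3) s3) q =
  rise (word3 e1 s1 e2 s2 e3 s3) q
  + (shift e1 (opp q) + shift e2 (opp q) + shift e3 (opp q)
     - (shift e1 q + shift e2 q + shift e3 q)).
  by rewrite /rise !altE opprD addrACA.
case: tri => [/(@shift_triangle _ _ _ q) -> | /(@shift_triangle _ _ _ q) tri].
  by rewrite subrr addr0.
rewrite [X in _ + (X - _)]addrAC tri [X in _ + (_ - X)]addrAC.
by rewrite subrr addr0.
Qed.

(** A side with two real ends would meet two real crossings, hence four real
    passages. *)
Lemma triangle_single_real e1 e2 e3 : triangle e1 e2 e3 ->
    (count real (strand e1 ++ strand e2 ++ strand e3) <= 2)%N ->
  all (fun e => [seq p <- strand (swap e) | real p] ==
                [seq p <- strand e | real p]) [:: e1; e2; e3].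
Proof.
have realopp q : real (opp q) = real q by [].
case=> d1 [d2 [d3 [/eqP[c12 _] /eqP[c23 _] /eqP[c31 _]]]].
have rE e d : count real (strand e) = (real (source e d) + real (target e d))%N.
  by case: d; rewrite /= addn0 // addnC.
have swapE e d : ~~ (real (source e d) && real (target e d)) ->
    [seq p <- strand (swap e) | real p] == [seq p <- strand e | real p].
  by case: d => /=; case: (real e.1); case: (real e.2); rewrite ?eqxx.
rewrite !count_cat (rE e1 d1) (rE e2 d2) (rE e3 d3) /= andbT.
rewrite -c12 -c23 -c31 !realopp => le2.
rewrite (swapE e1 d1) ?(swapE e2 d2) ?(swapE e3 d3) //
  -?c12 -?c23 -?c31 ?realopp //;
  by move: le2; do 3!case: (real (target _ _)).
Qed.

Lemma gauss_Omega3_single_real e1 s1 e2 s2 e3 s3 :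
    triangle e1 e2 e3 \/ triangle e1 e3 e2 ->
    (count real (strand e1 ++ strand e2 ++ strand e3) <= 2)%N ->
  [seq p <- word3 (swap e1) s1 (swap e2) s2 (swap e3) s3 | real p] =
  [seq p <- word3 e1 s1 e2 s2 e3 s3 | real p].
Proof.
move=> tri le2.
have : all (fun e => [seq p <- strand (swap e) | real p] ==
                     [seq p <- strand e | real p]) [:: e1; e2; e3].
  case: tri => tri; first exact: triangle_single_real tri le2.
  have p23 : perm_eq (strand e1 ++ strand e2 ++ strand e3)
                     (strand e1 ++ strand e3 ++ strand e2).
    by rewrite perm_cat2l perm_catC.
  rewrite (permP p23) in le2; have := triangle_single_real tri le2.
  by rewrite /= !andbT andbA andbAC -andbA.
case/and4P=> /eqP E1 /eqP E2 /eqP E3 _.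
by rewrite /word3 !filter_cat E1 E2 E3.
Qed.

(** * Invariance *)

Lemma chord_sum_gauss_move w w' :
    move w w' -> closed_curve w -> closed_curve w' ->
  chord_sum [seq p <- w | real p] = chord_sum [seq p <- w' | real p].
Proof.
move=> ww' /closed_gauss gcl /closed_gauss gcl'.
case: ww' gcl gcl' => {w w'}.
- move=> n w gcl _; rewrite /rot filter_cat -rot_size_cat.
  have wE : [seq p <- take n w | real p] ++ [seq p <- drop n w | real p] =
      [seq p <- w | real p].
    by rewrite -filter_cat cat_take_drop.
  by rewrite wE chord_sum_rot.
- move=> f w fk; rewrite filter_map.
  have -> : [seq p <- w | preim (fun p => (f p.1, p.2)) real p] =
      [seq p <- w | real p].
    by apply: eq_filter => p; rewrite /= /real /virtual /= fk.
  by move=> gcl /closed_uniq guniq; rewrite chord_sum_map.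
- move=> x s xr /=; have oxr : real (opp x) := xr.
  by rewrite xr oxr => gcl _; rewrite chord_sum_Omega1.
- move=> x s xv _ _ /=; have oxv : virtual (opp x) := xv.
  by rewrite /real xv oxv.
- move=> x y z s t xr yr xy2 xyz.
  have zr : [seq p <- z | real p] = z.
    have oxr : real (opp x) := xr; have oyr : real (opp y) := yr.
    by case: xyz => _ [] -> /=; rewrite oxr oyr.
  rewrite !filter_cat zr /= xr yr => gcl _.
  exact: chord_sum_Omega2.
- move=> x y z s t xv yv xyz _ _.
  have zr : [seq p <- z | real p] = [::].
    have oxv : virtual (opp x) := xv; have oyv : virtual (opp y) := yv.
    by case: xyz => _ [] -> /=; rewrite /real oxv oyv.
  by rewrite !filter_cat zr /= /real xv yv.
- move=> e1 e2 e3 s1 s2 s3 tri; rewrite !all_cat => /and3P[r1 r2 r3] _.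
  have realE e : all real (strand e) ->
      ([seq p <- strand e | real p] = strand e) *
      ([seq p <- strand (swap e) | real p] = strand (swap e)).
    by rewrite /= => /and3P[-> -> _].
  rewrite /word3 !filter_cat !(realE _ r1) !(realE _ r2) !(realE _ r3) => gcl _.
  by symmetry; apply: chord_sum_Omega3.
- move=> e1 e2 e3 s1 s2 s3 tri virt _ _; rewrite gauss_Omega3_single_real //.
  rewrite leqNgt; apply: contraL virt => lt2; rewrite -has_predC has_count.
  exact: leq_trans lt2.
- by move=> e1 e2 e3 s1 s2 s3 tri two _ _; rewrite gauss_Omega3_single_real // two.
Qed.

Theorem theorem3p1 (D D' : vdiagram) (hDD' : same_virtual_knot D D') :
  odd_writhe_polynomial D = odd_writhe_polynomial D'.
Proof.
elim: hDD' => {D D'} [D D' DD' | D | D D' _ -> | D1 D2 D3 _ -> _ ->] //.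
rewrite !odd_writhe_polynomial_chord_sum.
exact: chord_sum_gauss_move DD' (word_closed D) (word_closed D').
Qed.
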